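(* Let $m,d$ be natural numbers with $d\geqslant m+2$, and let $\varepsilon,c,C$ be positive constants. For each natural number $N$ let $L=L(N):\mathbb{R}^d\to\mathbb{R}^m$ be a linear map with $\Vert L\Vert_\infty\leqslant C$. Let $F:\mathbb{R}^d\to[0,1]$ be the indicator function of $[1,N]^d$ and $G:\mathbb{R}^m\to[0,1]$ the indicator function of $[-\varepsilon,\varepsilon]^m$. Assume that $\operatorname{dist}(L,V_{\mathrm{rank}}(m,d))\geqslant c$ and that $T^L_{F,G,N}(1,\dots,1)\gg_{c,C,\varepsilon}1$ for all large enough $N$. Suppose that $\liminf_{N\to\infty}\operatorname{dist}(L,V^*_{\mathrm{degen}}(m,d))=0$. Let $s$ be a natural number, let $H:\mathbb{R}_{>0}\to\mathbb{R}_{>0}$ be any function with $H(\rho)\to0$ as $\rho\to0$, and let $E_\rho(N)$ be an error term depending on a parameter $\rho$ with $E_\rho(N)\to0$ as $N\to\infty$ for each fixed $\rho$. Then there are infinitely many natural numbers $N$ for which there exist functions $f_1,\dots,f_d:[N]\to[-1,1]$ and some $\rho\leqslant1$ such that both $\min_j\Vert f_j\Vert_{U^{s+1}[N]}\leqslant\rho$ and $$|T^L_{F,G,N}(f_1,\dots,f_d)|>H(\rho)+E_\rho(N).$$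
   Context: Linear maps $\mathbb{R}^a\to\mathbb{R}^b$ are identified with their matrices; $\Vert L\Vert_\infty$ is the maximum absolute value of the entries; $\operatorname{dist}(X,Y)=\inf\Vert x-y\Vert_\infty$ over $x\in X,y\in Y$ (entries as coordinates). $V_{\mathrm{rank}}(m,d)$ is the set of $m\times d$ real matrices of rank less than $m$. $V^*_{\mathrm{degen}}(m,d)$ is the set of linear maps $L:\mathbb{R}^d\to\mathbb{R}^m$ for which there exist $i,j\leqslant d$ and $\lambda\in\mathbb{R}$ with $\mathbf e_i^*-\lambda\mathbf e_j^*\neq0$ and $\mathbf e_i^*-\lambda\mathbf e_j^*\in L^*((\mathbb{R}^m)^* )$ (equivalently, the row space of $L$ contains a non-zero vector with at most two non-zero coordinates). $X\gg_{c,C,\varepsilon}1$ means $X\geqslant K^{-1}$ for a constant $K$ depending on $c,C,\varepsilon,m,d$. $[N]=\{1,\dots,N\}$; the function $1$ denotes the constant function $1$ on $[N]$. Solution count: for $F$ supported on $[-N,N]^d$, compactly supported $G$, and $f_j:[N]\to[-1,1]$ extended by zero to $\mathbb{Z}$, $T^L_{F,G,N}(f_1,\dots,f_d)=N^{-(d-m)}\sum_{\mathbf n\in\mathbb{Z}^d}\prod_j f_j(n_j)F(\mathbf n)G(L\mathbf n)$. Gowers norm: for $g:\mathbb{Z}/N'\mathbb{Z}\to\mathbb{C}$, $\Vert g\Vert_{U^k(N')}^{2^k}=N'^{-(k+1)}\sum_{x,h_1,\dots,h_k}\prod_{\boldsymbol\omega\in\{0,1\}^k}\mathcal C^{|\boldsymbol\omega|}g(x+\mathbf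 h\cdot\boldsymbol\omega)$; for $f:[N]\to\mathbb{C}$, $\Vert f\Vert_{U^k[N]}=\Vert f1_{[N]}\Vert_{U^k(N')}/\Vert1_{[N]}\Vert_{U^k(N')}$ with $[N]\subseteq\mathbb{Z}/N'\mathbb{Z}$ and $N'/N$ sufficiently large in terms of $k$. *)

(* Defs.v *)
From HB Require Import structures.
From mathcomp Require Import all_boot all_order all_algebra.
From mathcomp Require Import all_classical all_reals all_analysis.
Set Implicit Arguments. Unset Strict Implicit. Unset Printing Implicit Defensive.
Import Order.TTheory GRing.Theory Num.Theory.
Local Open Scope classical_set_scope.
Local Open Scope ring_scope.

Section Defs.
Variable R : realType.

Definition mx_supnorm (m d : nat) (L : 'M[R]_(m, d)) : R :=
  \big[Num.max/0]_(p : 'I_m * 'I_d) `|L p.1 p.2|.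

(* dist(L, V) = inf_{M in V} ||L - M||_oo, in the extended reals (inf of the empty set = +oo) *)
Definition mx_dist (m d : nat) (L : 'M[R]_(m, d)) (V : set 'M[R]_(m, d)) : \bar R :=
  ereal_inf [set (mx_supnorm (L - M))%:E | M in V].

Definition V_rank (m d : nat) : set 'M[R]_(m, d) := [set M | (\rank M < m)%N].

(* V*_degen(m,d) : the row space of L (= L^*((R^m)^* )) contains e_i^* - lam e_j^* <> 0 *)
Definition V_degen (m d : nat) : set 'M[R]_(m, d) :=
  [set L | exists i j : 'I_d, exists lam : R,
     let v : 'rV[R]_d := delta_mx 0 i - lam *: delta_mx 0 j in
     v != 0 /\ (v <= L)%MS].

Definition lin_apply (m d : nat) (L : 'M[R]_(m, d)) (x : 'I_d -> R) : 'I_m -> R :=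
  fun i => \sum_(j < d) L i j * x j.

Definition box_pt (d N : nat) (k : {ffun 'I_d -> 'I_(2 * N + 1)}) : 'I_d -> int :=
  fun j => (k j)%:Z - N%:Z.

Definition ext0 (N : nat) (f : nat -> R) (n : int) : R :=
  if (1 <= n) && (n <= N%:Z) then f (absz n) else 0.

(* T^L_{F,G,N}(f_1,...,f_d), for F supported on [-N,N]^d (so the sum over Z^d
   reduces to the sum over the box [-N,N]^d) *)
Definition solT (m d : nat) (L : 'M[R]_(m, d)) (F : ('I_d -> R) -> R)
    (G : ('I_m -> R) -> R) (N : nat) (f : 'I_d -> nat -> R) : R :=
  (N%:R ^- (d - m)) *
  \sum_(k : {ffun 'I_d -> 'I_(2 * N + 1)})
     ((\prod_(j < d) ext0 N (f j) (box_pt k j)) *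
      F (fun j => (box_pt k j)%:~R) *
      G (lin_apply L (fun j => (box_pt k j)%:~R))).

Definition ind_box1N (d N : nat) (x : 'I_d -> R) : R :=
  if [forall j, (1 <= x j) && (x j <= N%:R)] then 1 else 0.

Definition ind_cube (m : nat) (eps : R) (y : 'I_m -> R) : R :=
  if [forall i, `|y i| <= eps] then 1 else 0.

(* ||g||_{U^k(N')}^{2^k} for g : Z/N'Z -> R (g given on residues 0..N'-1);
   g is real-valued so the conjugations are trivial *)
Definition gowers_pow (N' k : nat) (g : nat -> R) : R :=
  (N'%:R ^- k.+1) *
  \sum_(x < N') \sum_(h : {ffun 'I_k -> 'I_N'})
     \prod_(w : {ffun 'I_k -> bool})
        g ((x + \sum_(i < k | w i) (h i : nat)) %% N')%N.

Definition gowers_norm (N' k : nat) (g : nat -> R) : R :=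
  powR (gowers_pow N' k g) (2%:R ^+ k)^-1.

Definition gowersN (k N : nat) (f : nat -> R) : R :=
  let N' := (2 ^ (k + 1) * N + 1)%N in
  let emb (h : nat -> R) := fun x : nat => if (1 <= x <= N)%N then h x else 0 in
  gowers_norm N' k (emb f) / gowers_norm N' k (emb (fun _ => 1)).

End Defs.

(* Main.v *)
(** Near-degeneracy along a subsequence of [N] gives a vector [e_i - lam e_j] with
    [i <> j] close to the row space of [L], so every solution [n] counted by [T(1)]
    has [|n_i - lam n_j| <= Delta], where [Delta] is small compared with [N].
    Cut the integers into blocks of length [B], with [Delta << B << N] and a shift
    [t < B], and choose independent random signs on the blocks. Let [f_i n] be the
    sign of the block of [n], let [f_j n] be the sign of the block of [lam n]
    (rounded), and let the other functions be [1]. On average over the shift, almost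
    every solution has [n_i] and [lam n_j] in the same block, so [T(f)] is close to
    [T(1)]; on average over the signs, only the cubes with two vertices in a common
    block contribute to the Gowers norm of [f_i], which is thus small. Some choice of
    shift and signs satisfies both for one fixed [rho] with [H rho] small, so
    neither the decay rate of [H] nor that of [E] matters. *)
Require Import Defs.
From HB Require Import structures.
From mathcomp Require Import all_boot all_order all_algebra.
From mathcomp Require Import all_classical all_reals all_analysis.
From mathcomp Require Import zify ring lra.
Import Order.TTheory GRing.Theory Num.Theory.
Local Open Scope classical_set_scope.
Local Open Scope ring_scope.
Set Implicit Arguments. Unset Strict Implicit. Unset Printing Implicit Defensive.

(** * Cube sums over a finite abelian group *)

Section CubeSums.
Variables (V : finZmodType) (k : nat).
Implicit Types (h : {ffun 'I_k -> V}) (w : {ffun 'I_k -> bool}).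

Definition cube_dir w h : V := \sum_(i < k | w i) h i.

Definition single (i0 : 'I_k) (r : V) : {ffun 'I_k -> V} :=
  [ffun i => if i == i0 then r else 0].

Lemma cube_dirD_single w h i0 r :
  cube_dir w (h + single i0 r) = cube_dir w h + (if w i0 then r else 0).
Proof.
rewrite /cube_dir; under eq_bigr do rewrite !ffunE.
rewrite big_split /=; congr (_ + _).
rewrite -big_mkcondr /=; case: ifP => wi0.
  rewrite (eq_bigl (pred1 i0)) ?big_pred1_eq // => i /=.
  by case: eqP => [->|]; rewrite ?andbF ?wi0.
by rewrite big_pred0 // => i; case: eqP => [->|]; rewrite ?andbF ?wi0.
Qed.

(** Translation by [single i0 r] permutes the [h]; this frees one direction of the cube while the
    others stay fixed. *)
Lemma sum_shift_single (R : nmodType) i0 (Phi : {ffun 'I_k -> V} -> R) :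
  (\sum_(h : {ffun 'I_k -> V}) Phi h) *+ #|V| =
  \sum_(h : {ffun 'I_k -> V}) \sum_(r : V) Phi (h + single i0 r).
Proof.
rewrite exchange_big /= -sumr_const; apply: eq_bigr => r _.
by rewrite [LHS](reindex_inj (addIr (single i0 r))).
Qed.

(** A vertex other than the base point is equidistributed: varying [h i0] alone moves it once
    through [V]. *)
Lemma sum_cube_vertex (R : nmodType) w i0 (psi : V -> R) x : w i0 ->
  (\sum_h psi (x + cube_dir w h)) *+ #|V| = (\sum_y psi y) *+ #|V| ^ k.
Proof.
move=> wi0; rewrite (sum_shift_single i0).
have cardh : #|{ffun 'I_k -> V}| = (#|V| ^ k)%N by rewrite card_ffun card_ord.
rewrite -cardh -sumr_const; apply: eq_bigr => h _.
rewrite [RHS](reindex_inj (addrI (x + cube_dir w h))).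
by apply: eq_bigr => r _; rewrite cube_dirD_single wi0 addrA.
Qed.

Definition cube_sum (R : comPzRingType) (g : V -> R) : R :=
  \sum_x \sum_h \prod_w g (x + cube_dir w h).

(* Isolating one direction [r] of the cube, the sum becomes a sum of
   terms [P x * P (x + r)] over [x] and [r], i.e. a sum of squares. *)
Lemma cube_sum_ge0 (R : realFieldType) (g : V -> R) (i0 : 'I_k) :
  0 <= cube_sum g.
Proof.
pose P x h := \prod_(w : {ffun 'I_k -> bool} | ~~ w i0) g (x + cube_dir w h).
have PD x h r : P x (h + single i0 r) = P x h.
  by apply: eq_bigr => w /negPf wi0; rewrite cube_dirD_single wi0 addr0.
(* [flip] matches the face without [i0] with the opposite face, which is the same face based at
   [x + h i0]. *)
pose flip w : {ffun 'I_k -> bool} := [ffun i => w i (+) (i == i0)].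
have flipK : involutive flip.
  by move=> w; apply/ffunP => i; rewrite !ffunE -addbA addbb addbF.
have cube_flip w h : ~~ w i0 -> cube_dir (flip w) h = h i0 + cube_dir w h.
  move=> wi0; rewrite /cube_dir (bigD1 i0) /= ?ffunE ?eqxx ?(negPf wi0) //.
  congr (_ + _); apply: eq_bigl => i; rewrite ffunE.
  by case: eqP => [->|] /=; rewrite ?andbF ?(negPf wi0) ?andbT ?addbF.
have prodE x h : \prod_w g (x + cube_dir w h) = P x h * P (x + h i0) h.
  rewrite (bigID (fun w : {ffun 'I_k -> bool} => ~~ w i0)) /=; congr (_ * _).
  rewrite (reindex_inj (inv_inj flipK)) /=.
  have flipi0 w : ~~ ~~ flip w i0 = ~~ w i0.
    by rewrite negbK ffunE eqxx addbT.
  rewrite (eq_bigl _ _ flipi0); apply: eq_bigr => w wi0.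
  by rewrite cube_flip // addrA.
have V0 : (0 < #|V|)%N by apply/card_gt0P; exists 0.
suff : 0 <= cube_sum g *+ #|V| by rewrite pmulrn_lge0.
rewrite /cube_sum exchange_big /= (sum_shift_single i0) sumr_ge0 // => h _.
rewrite (_ : \sum_r _ = (\sum_x P x h) ^+ 2) ?sqr_ge0 //.
rewrite exchange_big expr2 mulr_suml /=; apply: eq_bigr => x _.
rewrite [in RHS](reindex_inj (addrI (x + h i0))) mulr_sumr.
by apply: eq_bigr => r _; rewrite prodE !PD !ffunE eqxx addrA.
Qed.

End CubeSums.

(** * Independent random signs on blocks *)

Section RandomSigns.
Variables (R : realFieldType) (T : finType).

Definition sgn_of (b : bool) : R := (-1) ^+ b.

Definition flip_at (u : T) (sg : {ffun T -> bool}) : {ffun T -> bool} :=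
  [ffun v => sg v (+) (v == u)].

Lemma sum_signs_eq0 u (Phi : {ffun T -> bool} -> R) :
  (forall sg, Phi (flip_at u sg) = - Phi sg) -> \sum_sg Phi sg = 0.
Proof.
move=> Phi_odd; have flipK : involutive (flip_at u).
  by move=> sg; apply/ffunP => v; rewrite !ffunE -addbA addbb addbF.
have : \sum_sg Phi sg = - \sum_sg Phi sg.
  rewrite {1}(reindex_inj (inv_inj flipK)) -sumrN.
  by apply: eq_bigr => sg _; rewrite Phi_odd.
lra.
Qed.

Lemma sgn_of_flip_at u sg v :
  sgn_of (flip_at u sg v) = (if v == u then -1 else 1) * sgn_of (sg v).
Proof.
by rewrite /sgn_of ffunE signr_addb mulrC; case: eqP; rewrite ?expr0 ?expr1.
Qed.

Lemma sum_sign_pair (u v : T) :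
  \sum_(sg : {ffun T -> bool}) sgn_of (sg u) * sgn_of (sg v) =
  (u == v)%:R * 2 ^+ #|T|.
Proof.
case: eqVneq => [->|uv].
  under eq_bigr do rewrite -expr2 sqrr_sign.
  by rewrite sumr_const card_ffun card_bool natrX mul1r.
rewrite mul0r (@sum_signs_eq0 u) // => sg.
by rewrite !sgn_of_flip_at eqxx eq_sym (negPf uv) mul1r mulN1r mulNr.
Qed.

Variables (V : finZmodType) (k : nat) (A : pred V) (b : V -> T) (B : nat).
Hypothesis fibre_le : forall x, A x -> (#|[pred y | A y & b y == b x]| <= B)%N.

Definition block_sign (sg : {ffun T -> bool}) (v : V) : R :=
  if A v then sgn_of (sg (b v)) else 0.

(* A cube survives averaging only if its base vertex shares a block with
   another vertex. *)
Lemma sum_signs_cube x (h : {ffun 'I_k -> V}) :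
  \sum_sg \prod_w block_sign sg (x + cube_dir w h) <=
  2 ^+ #|T| * \sum_(w | w != [ffun=> false])
    (A x && [&& A (x + cube_dir w h) & b (x + cube_dir w h) == b x])%:R.
Proof.
pose Q w := A x && [&& A (x + cube_dir w h) & b (x + cube_dir w h) == b x].
change (\sum_sg \prod_w block_sign sg (x + cube_dir w h) <=
  2 ^+ #|T| * \sum_(w | w != [ffun=> false]) (Q w)%:R).
have w0E : cube_dir [ffun=> false] h = 0.
  by rewrite /cube_dir big_pred0 // => i; rewrite ffunE.
have T0 : 0 <= 2 ^+ #|T| :> R by rewrite exprn_ge0 // ler0n.
(* If some other vertex shares the block of [x], its term on the right pays for the trivial bound
   [1] on each product. *)
case: (pickP [pred w | (w != [ffun=> false]) && Q w]) => [w /andP[w0 Qw]|noQ].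
  apply: (@le_trans _ _ (2 ^+ #|T|)); last first.
    rewrite -[leLHS]mulr1 ler_wpM2l // (bigD1 w) //= -/(Q w) Qw lerDl.
    by rewrite sumr_ge0 // => *; rewrite ler0n.
  rewrite (_ : 2 ^+ #|T| = \sum_(sg : {ffun T -> bool}) 1); last first.
    by rewrite sumr_const card_ffun card_bool natrX.
  apply: ler_sum => sg _; apply: le_trans (ler_norm _) _.
  rewrite normr_prod; apply: prodr_ile1 => w' _; rewrite normr_ge0 /=.
  by rewrite /block_sign; case: ifP; rewrite ?normr_sign ?normr0 ?ler01.
rewrite [X in _ * X]big1 ?mulr0; last first.
  by move=> w w0; have := noQ w; rewrite /= w0 /= => ->.
case: (pickP [pred w | ~~ A (x + cube_dir w h)]) => [w /= Aw|allA].
  rewrite big1 // => sg _; rewrite (bigD1 w) //= /block_sign (negPf Aw).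
  by rewrite mul0r.
have {allA} allA w : A (x + cube_dir w h) by have /negbFE := allA w.
have Ax : A x by have := allA [ffun=> false]; rewrite w0E addr0.
(* No other vertex lies in the block of [x], so flipping the sign of that block changes exactly one
   factor. *)
rewrite (@sum_signs_eq0 (b x)) // => sg.
rewrite (bigD1 [ffun=> false]) //= [in RHS](bigD1 [ffun=> false]) //= -mulNr.
congr (_ * _).
  by rewrite /block_sign w0E addr0 Ax sgn_of_flip_at eqxx mulN1r.
apply: eq_bigr => w w0; rewrite /block_sign allA sgn_of_flip_at.
by have := noQ w; rewrite /= w0 /= /Q Ax allA /= => ->; rewrite mul1r.
Qed.

(** For given [x] and [w], the vertex is equidistributed and has at most [B] positions in the block
    of [x]. On average the trivial bound [#|V| ^ k.+1] thus improves by a factor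
    [2 ^ k * B / #|V|]. *)
Lemma sum_signs_cube_sum :
  \sum_sg cube_sum k (block_sign sg) <=
  2 ^+ #|T| * (2 ^+ k * (#|V|%:R ^+ k * B%:R)).
Proof.
rewrite /cube_sum exchange_big /=.
under eq_bigr do rewrite exchange_big /=.
apply: le_trans (ler_sum _ (fun x _ => ler_sum _ (fun h _ => sum_signs_cube x h))) _.
under eq_bigr do rewrite -mulr_sumr exchange_big /=.
rewrite -mulr_sumr ler_wpM2l ?exprn_ge0 ?ler0n // exchange_big /=.
have Vgt0 : (0 < #|V|)%N by apply/card_gt0P; exists 0.
apply: (@le_trans _ _ (\sum_(w : {ffun 'I_k -> bool}) (#|V|%:R ^+ k * B%:R))); last first.
  by rewrite sumr_const card_ffun card_bool card_ord -[leLHS]mulr_natl natrX.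
rewrite big_mkcond; apply: ler_sum => w _; case: ifP => [w0|_]; last first.
  by rewrite mulr_ge0 ?exprn_ge0 ?ler0n.
have [i0 wi0] : exists i, w i.
  apply/existsP; move: w0; apply: contraR; rewrite negb_exists => /forallP wF.
  by apply/eqP/ffunP => i; rewrite ffunE; apply/negbTE/wF.
have Vgt0R : 0 < #|V|%:R :> R by rewrite ltr0n.
rewrite -(ler_pM2l Vgt0R) mulr_sumr.
rewrite [leRHS](_ : _ = \sum_(x : V) (#|V|%:R ^+ k * B%:R)); last first.
  by rewrite sumr_const mulr_natl.
apply: ler_sum => x _.
rewrite mulr_natl (sum_cube_vertex (fun y => (A x && (A y && (b y == b x)))%:R) x wi0).
rewrite -[leLHS]mulr_natl natrX ler_wpM2l ?exprn_ge0 ?ler0n //.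
case Ax: (A x); last by rewrite big1 ?ler0n.
rewrite -natr_sum ler_nat; apply: leq_trans (fibre_le Ax).
by rewrite -sum1_card [leqRHS]big_mkcond leq_sum //= => y _; case: ifP.
Qed.

End RandomSigns.

(** * Gowers norms on intervals *)

Section GowersNorms.
Variable R : realType.
Implicit Types (f g : nat -> R) (N k n : nat).

Lemma val_cube_dir n k (w : {ffun 'I_k -> bool}) (h : {ffun 'I_k -> 'I_n.+1}) :
  val (cube_dir w h) = ((\sum_(i < k | w i) (h i : nat)) %% n.+1)%N.
Proof.
rewrite /cube_dir; elim/big_rec2: _ => [|i y x _ yE]; first by rewrite mod0n.
by rewrite [LHS]/= -[nat_of_ord x]/(val x) yE modnDmr.
Qed.

Lemma gowers_powE n k g :
  gowers_pow n.+1 k g =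
  n.+1%:R ^- k.+1 * cube_sum k (fun v : 'I_n.+1 => g v).
Proof.
rewrite /gowers_pow /cube_sum; congr (_ * _).
apply: eq_bigr => x _; apply: eq_bigr => h _; apply: eq_bigr => w _.
by congr g; rewrite /= val_cube_dir modnDmr.
Qed.

(** A direction is required here: at order zero the cube sum is just the sum of [g], of any sign. *)
Lemma gowers_pow_ge0 n k g : 0 <= gowers_pow n.+1 k.+1 g.
Proof.
by rewrite gowers_powE mulr_ge0 ?invr_ge0 ?exprn_ge0 ?ler0n ?(cube_sum_ge0 _ ord0).
Qed.

Definition trunc N f := fun x : nat => if (1 <= x <= N)%N then f x else 0.

(** Keep only [x] and [h i] in [[1, q]]: all vertices then lie in [[1, N]], and [N <= n] rules out
    wrap-around. *)
Lemma gowers_pow_trunc1_ge N n k q :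
  (k.+1 * q <= N)%N -> (N <= n)%N ->
  (q%:R / n.+1%:R) ^+ k.+1 <= gowers_pow n.+1 k (trunc N (fun=> 1)).
Proof.
move=> qN Nn; rewrite exprMn mulrC exprVn /gowers_pow.
rewrite ler_wpM2l ?invr_ge0 ?exprn_ge0 ?ler0n //.
have q_count : \sum_(y < n.+1) (0 < y <= q)%:R = q%:R :> R.
  rewrite -natr_sum big_ord_recl add0n; congr _%:R.
  have -> p : (\sum_(i < p) (0 < lift ord0 i <= q) = minn p q)%N.
    elim: p => [|p IHp]; first by rewrite big_ord0 min0n.
    by rewrite big_ord_recr /= IHp /bump; lia.
  by apply/minn_idPr; move: qN; lia.
rewrite exprS -{1}q_count mulr_suml; apply: ler_sum => x _.
have -> : q%:R ^+ k = \sum_(h : {ffun 'I_k -> 'I_n.+1})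
     \prod_(i < k) (0 < h i <= q)%:R :> R.
  by rewrite -(bigA_distr_bigA (fun (_ : 'I_k) (y : 'I_n.+1) =>
      (0 < y <= q)%:R)) /= q_count prodr_const card_ord.
rewrite mulr_sumr; apply: ler_sum => h _.
have trunc_ge0 y : 0 <= trunc N (fun=> 1) y :> R by rewrite /trunc; case: ifP.
have [/andP[x0 xq]|] := boolP (0 < x <= q)%N; last by rewrite mul0r prodr_ge0.
rewrite mul1r.
have [/forallP hq|] := boolP [forall i, 0 < h i <= q]%N; last first.
  move=> /forallPn[i /negPf hi].
  by rewrite (bigD1 i) //= hi mul0r prodr_ge0.
rewrite [leRHS]big1 => [|w _].
  by apply: prodr_ile1 => i; rewrite hq ler01 lexx.
have sum_le : (\sum_(i < k | w i) h i <= k * q)%N.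
  rewrite big_mkcond (leq_trans (leq_sum _ (_ : forall i, _ -> _ <= q)%N)) //.
    by move=> i _; case: ifP => // _; have /andP[] := hq i.
  by rewrite sum_nat_const card_ord.
have xsum : (0 < x + \sum_(i < k | w i) h i <= N)%N.
  by rewrite addn_gt0 x0 (leq_trans _ qN) // mulSn leq_add.
by rewrite modn_small /trunc ?xsum // ltnS (leq_trans _ Nn) //; case/andP: xsum.
Qed.

(** Take [q = N %/ k.+1], which is at least [N / (2 * k.+1)] once [k < N]. The modulus is at most
    [2 ^ k.+2 * N], so their ratio is at least the inverse of this base, for every such [N]. *)
Definition gowers_trunc1_lb k : R := (2 ^+ k.+3 * k.+1%:R) ^- k.+1.

Lemma gowers_trunc1_lb_gt0 k : 0 < gowers_trunc1_lb k.
Proof. by rewrite invr_gt0 exprn_gt0 // mulr_gt0 ?exprn_gt0 ?ltr0n. Qed.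

Lemma gowers_pow_trunc1_lb N k : (k < N)%N ->
  gowers_trunc1_lb k <= gowers_pow (2 ^ (k + 1) * N).+1 k (trunc N (fun=> 1)).
Proof.
move=> kN; have p0 : (0 < 2 ^ (k + 1))%N by rewrite expn_gt0.
have qN : (k.+1 * (N %/ k.+1) <= N)%N by rewrite mulnC leq_trunc_div.
apply: le_trans (gowers_pow_trunc1_ge qN (leq_pmull N p0)).
rewrite /gowers_trunc1_lb -[2 ^+ _]natrX -natrM -exprVn.
rewrite lerXn2r ?nnegrE ?divr_ge0 ?invr_ge0 ?ler0n //.
have -> : (2 ^ k.+3 = 4 * 2 ^ (k + 1))%N by rewrite addn1 !expnS; lia.
rewrite ler_pdivlMr ?ltr0n // mulrC ler_pdivrMr ?ltr0n ?muln_gt0 ?p0 //.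
have := ltn_ceil N (ltn0Sn k).
have q1 : (0 < N %/ k.+1)%N by rewrite divn_gt0.
rewrite -natrM ler_nat; move: (_ %/ _)%N (2 ^ _)%N q1 p0 => q p.
nia.
Qed.

Lemma gowersN_le k N f (rho : R) : (k < N)%N -> (0 < k)%N -> 0 < rho ->
  gowers_pow (2 ^ (k + 1) * N).+1 k (trunc N f) <=
    rho ^+ (2 ^ k) * gowers_trunc1_lb k ->
  gowersN k N f <= rho.
Proof.
case: k => // k kN _ rho0 gf_le.
have lb := gowers_pow_trunc1_lb kN; have lb0 := gowers_trunc1_lb_gt0 k.+1.
rewrite /gowersN addn1 -[X in gowers_norm _ _ X / _]/(trunc N f).
rewrite -[X in _ / gowers_norm _ _ X]/(trunc N (fun=> 1)) /gowers_norm.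
have p0 : 0 < 2 ^+ k.+1 :> R by rewrite exprn_gt0.
rewrite ler_pdivrMr ?powR_gt0 ?(lt_le_trans lb0) //.
have rhoE : rho = (rho ^+ (2 ^ k.+1)) `^ (2 ^+ k.+1)^-1.
  by rewrite -powR_mulrn ?(ltW rho0) // -powRrM natrX divff ?gt_eqF // powRr1 // ltW.
have := gowers_pow_ge0 (2 ^ (k.+1 + 1) * N) k (trunc N f).
move: (gowers_pow _ _ (trunc N f)) gf_le => a a_le a0.
have b0 := le_trans (ltW lb0) lb; move: (gowers_pow _ _ _) lb b0 => b lb b0.
rewrite [X in X * _]rhoE -powRM ?exprn_ge0 ?(ltW rho0) //.
rewrite ge0_ler_powR ?nnegrE ?invr_ge0 ?(ltW p0) ?mulr_ge0 ?exprn_ge0 ?(ltW rho0) //.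
by apply: le_trans a_le _; rewrite ler_pM2l ?exprn_gt0.
Qed.

(** * Shifted blocks of length [B] *)

Section Blocks.
Variables (N B : nat).
Hypothesis B_gt0 : (0 < B)%N.

(** For [t < B] and [n <= N] the index fits, so [inord] does not fall back on its default. The type
    is free of [t], so one space of signs serves all shifts. *)
Definition block (t n : nat) : 'I_(N + B).+1 := inord ((n + t) %/ B).

Definition block_signs (t : nat) (sg : {ffun 'I_(N + B).+1 -> bool}) (n : nat) : R :=
  sgn_of R (sg (block t n)).

Lemma val_block t n : (t < B)%N -> (n <= N)%N -> val (block t n) = ((n + t) %/ B)%N.
Proof.
move=> tB nN; rewrite /= inordK // ltnS.
by apply: leq_trans (leq_div _ _) _; lia.
Qed.

(** In one block, [y] is determined by the residue of [y + t] modulo [B]. *)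
Lemma block_fibre n t (x : 'I_n.+1) : (t < B)%N -> (1 <= x <= N)%N ->
  (#|[pred y : 'I_n.+1 | (1 <= y <= N)%N & block t y == block t x]| <= B)%N.
Proof.
move=> tB /andP[_ xN]; rewrite -[leqRHS]card_ord.
pose res (y : 'I_n.+1) : 'I_B := Ordinal (ltn_pmod (y + t) B_gt0).
apply: (leq_card_in res) => y z; rewrite !inE.
move=> /andP[/andP[_ yN] /eqP/(congr1 val)] + /andP[/andP[_ zN] /eqP/(congr1 val)].
rewrite !val_block // => yE zE /(congr1 val) /= yzE.
apply/val_inj/(@addIn t) => /=.
by rewrite (divn_eq (y + t) B) yE yzE -zE -divn_eq.
Qed.

(** The factor [2 ^ k] from the cube bound is absorbed by the modulus, which exceeds
    [2 ^ k.+1 * N]. *)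
Lemma sum_signs_gowers_pow k t : (0 < N)%N -> (t < B)%N ->
  \sum_sg gowers_pow (2 ^ (k + 1) * N).+1 k (trunc N (block_signs t sg)) <=
  2 ^+ (N + B).+1 * (B%:R / N%:R).
Proof.
move=> N_gt0 tB; set n := (2 ^ (k + 1) * N)%N.
pose A (x : 'I_n.+1) := (1 <= x <= N)%N.
have := @sum_signs_cube_sum R _ 'I_n.+1 k A (fun x => block t x) B
  (fun x => @block_fibre n t x tB).
rewrite !card_ord => le_cube.
have -> : \sum_sg gowers_pow n.+1 k (trunc N (block_signs t sg)) =
    n.+1%:R ^- k.+1 * \sum_sg
      cube_sum k (@block_sign R _ 'I_n.+1 A (fun x => block t x) sg).
  by rewrite mulr_sumr; apply: eq_bigr => sg _; rewrite gowers_powE.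
have n0 : 0 < n.+1%:R :> R by rewrite ltr0n.
rewrite mulrC ler_pdivrMr ?exprn_gt0 //; apply: le_trans le_cube _.
rewrite -mulrA ler_wpM2l ?exprn_ge0 // exprS.
rewrite [leRHS](_ : _ = (n.+1%:R / N%:R) * (n.+1%:R ^+ k * B%:R)); last by ring.
rewrite ler_wpM2r ?mulr_ge0 ?exprn_ge0 ?ler0n // ler_pdivlMr ?ltr0n //.
rewrite -natrX -natrM ler_nat /n addn1 expnS; lia.
Qed.

(** Hermite's identity: raising [n] by one trades the summand [n %/ B] for [(n + B) %/ B], one
    larger. *)
Lemma sum_div_shift n : (\sum_(t < B) (n + t) %/ B = n)%N.
Proof.
elim: n => [|n IHn]; first by rewrite big1 // => t _; rewrite divn_small // add0n.
have : ((n + B) %/ B + \sum_(t < B) (n + t) %/ B = n %/ B + \sum_(t < B) (n.+1 + t) %/ B)%N.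
  rewrite addnC -(big_ord_recr B (fun t => (n + t) %/ B)%N) big_ord_recl /= addn0.
  by congr addn; apply: eq_bigr => t _; rewrite /= addSnnS.
rewrite IHn divnDr ?dvdnn // divnn B_gt0; lia.
Qed.

(** A separating shift makes the two block indices differ by at least one, and by Hermite's identity
    these differences sum to the distance of [x] and [y]. *)
Lemma card_shift_separating x y D : (x <= N)%N -> (y <= N)%N ->
  (x <= y + D)%N -> (y <= x + D)%N ->
  (\sum_(t < B) (block t x != block t y) <= D)%N.
Proof.
wlog xy : x y / (x <= y)%N.
  move=> WL xN yN xyD yxD; case: (leqP x y) => [|/ltnW] xy; first exact: WL.
  by under eq_bigr do rewrite eq_sym; apply: WL.
move=> xN yN _ yxD; apply: (@leq_trans (y - x)%N); last by lia.
rewrite leq_subRL // -{1}(sum_div_shift x) -{2}(sum_div_shift y) -big_split /=.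
apply: leq_sum => t _; rewrite -val_eqE !val_block //.
have := @leq_div2r B (x + t) (y + t); lia.
Qed.

End Blocks.
End GowersNorms.

(** * Nearly degenerate matrices and their solutions *)

(** The lower limit is the supremum of the tail infima, so each of these is at most zero. *)
Lemma limn_einf_eq0_lt (R : realType) (u : nat -> \bar R) :
  limn_einf u = 0%E -> forall eta : R, 0 < eta ->
  forall N0, exists2 N, (N0 <= N)%N & (u N < eta%:E)%E.
Proof.
move=> u0 eta eta0 N0.
have : (einfs u N0 < eta%:E)%E.
  apply: (@le_lt_trans _ _ 0%E); last by rewrite lte_fin.
  rewrite -u0 limn_einf_lim (cvg_lim _ (@cvg_einfs_sup _ u)) //.
  by apply: ereal_sup_ubound; exists N0.
by move=> /ereal_inf_lt[_ [N /= N0N <-] uN]; exists N.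
Qed.

Section Degenerate.
Variables (R : realType) (m d : nat).
Implicit Types (L M : 'M[R]_(m, d)).

Lemma le_mx_supnorm L i j : `|L i j| <= mx_supnorm L.
Proof. exact: (le_bigmax _ (fun p : 'I_m * 'I_d => `|L p.1 p.2|) (i, j)). Qed.

Lemma mx_supnorm_le L (a : R) : 0 <= a ->
  (forall i j, `|L i j| <= a) -> mx_supnorm L <= a.
Proof. by move=> a0 La; apply/bigmax_leP; split=> // -[i j] _; apply: La. Qed.

(** If [i = j], the vector is a multiple of [delta_mx 0 i], and another index with [lam = 0] will
    do. If [|lam| > 1], dividing by [- lam] swaps the indices. All entries are then at most [1] in
    size. *)
Lemma V_degen_normal_form M : (1 < d)%N -> V_degen M ->
  exists i j (lam : R) (u : 'rV[R]_m),
    [/\ i != j, `|lam| <= 1 & u *m M = delta_mx 0 i - lam *: delta_mx 0 j].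
Proof.
move=> d1 [i [j [lam /= [v0 /submxP[u uM]]]]].
have [ij|ij] := eqVneq i j.
  have vE : delta_mx 0 i - lam *: delta_mx 0 i = (1 - lam) *: delta_mx 0 i :> 'rV[R]_d.
    by rewrite scalerBl scale1r.
  rewrite -ij vE in v0 uM.
  have [j' ij'] : exists j' : 'I_d, i != j'.
    pose a := Ordinal (ltnW d1); pose b := Ordinal d1.
    by have [->|] := eqVneq i a; [exists b|exists a].
  exists i, j', 0, ((1 - lam)^-1 *: u); rewrite normr0 ler01; split => //.
  have lam1 : 1 - lam != 0 by apply: contraNneq v0 => ->; rewrite scale0r.
  by rewrite -scalemxAl -uM scalerA mulVf // scale0r subr0 scale1r.
have [lam1|lam1] := leP `|lam| 1; first by exists i, j, lam, u.
have lam0 : lam != 0 by apply: contraTneq lam1 => ->; rewrite normr0 -leNgt ler01.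
exists j, i, lam^-1, (- lam^-1 *: u); rewrite eq_sym ij; split => //.
  by rewrite normfV invf_le1 ?ltW // normr_gt0.
by rewrite -scalemxAl -uM scalerBr scalerA mulNr mulVf // scaleN1r scaleNr opprK addrC.
Qed.

(* Subtracting [v / u_p] from the row [p] of [M] makes [u] a left null vector,
   so [M] is within [1 / |u_p|] of the rank-deficient matrices. *)
Lemma row_coef_bound L M (u : 'rV[R]_m) (w : 'rV[R]_d) (c eta : R) :
  0 < c -> eta <= c / 2 -> (c%:E <= mx_dist L (@V_rank R m d))%E ->
  mx_supnorm (L - M) <= eta -> u *m M = w -> (forall q, `|w 0 q| <= 1) ->
  forall p, `|u 0 p| <= 2 / c.
Proof.
move=> c0 eta_c distL LM uM w1 p.
have [->|up] := eqVneq (u 0 p) 0; first by rewrite normr0 divr_ge0 // ltW.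
have up0 : 0 < `|u 0 p| by rewrite normr_gt0.
pose M' := M - (u 0 p)^-1 *: (delta_mx p 0 *m w).
have uM' : u *m M' = 0.
  rewrite mulmxBr uM -scalemxAr mulmxA.
  rewrite (_ : u *m delta_mx p 0 = (u 0 p)%:M); last first.
    by rewrite -colE [LHS]mx11_scalar !mxE.
  by rewrite mul_scalar_mx scalerA mulVf // scale1r subrr.
have rM' : (\rank M' < m)%N.
  rewrite ltn_neqAle rank_leq_row andbT; apply: contraNneq up => /eqP freeM'.
  by move/eqP: uM'; rewrite mulmx_free_eq0 // => /eqP ->; rewrite mxE.
have : c <= eta + `|u 0 p|^-1.
  rewrite -lee_fin; apply: le_trans distL _.
  apply: (@le_trans _ _ (mx_supnorm (L - M'))%:E).
    by apply: ereal_inf_lbound; exists M'.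
  rewrite lee_fin mx_supnorm_le // => [|i j].
    by rewrite addr_ge0 ?invr_ge0 // (le_trans _ LM) // bigmax_ge_id.
  rewrite (_ : (L - M') i j = (L - M) i j + (u 0 p)^-1 * ((i == p)%:R * w 0 j)); last first.
    rewrite !mxE big_ord1 !mxE eqxx andbT; ring.
  apply: le_trans (ler_normD _ _) _.
  rewrite lerD ?(le_trans (le_mx_supnorm _ _ _)) // normrM normfV.
  rewrite ler_piMr ?invr_ge0 // normrM mulr_ile1 ?normr_ge0 //.
  by case: eqP; rewrite ?normr1 ?normr0.
move=> cle; have cu : c / 2 <= `|u 0 p|^-1 by lra.
by rewrite -[leRHS]invf_div -[leLHS]invrK lef_pV2 ?posrE ?invr_gt0 ?divr_gt0.
Qed.

(** The left side is [u] applied to [M x = L x - (L - M) x]. In each coordinate the first part is at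
    most [eps] and the second at most [d * eta * N]. *)
Lemma near_degen_solution L M (u : 'rV[R]_m) i j (lam eps eta U : R) N (x : 'I_d -> R) :
  u *m M = delta_mx 0 i - lam *: delta_mx 0 j ->
  (forall p, `|u 0 p| <= U) -> mx_supnorm (L - M) <= eta ->
  (forall q, `|x q| <= N) -> (forall p, `|lin_apply L x p| <= eps) ->
  `|x i - lam * x j| <= m%:R * (U * (eps + d%:R * (eta * N))).
Proof.
move=> uM uU LM xN Lx.
have -> : x i - lam * x j =
    \sum_p u 0 p * (lin_apply L x p - \sum_q (L - M) p q * x q).
  transitivity (\sum_q (u *m M) 0 q * x q).
    rewrite uM; under eq_bigr do rewrite !mxE eqxx /= mulrBl.
    rewrite sumrB; congr (_ - _).
      rewrite (bigD1 i) //= eqxx mul1r big1 ?addr0 // => q /negPf.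
      by rewrite eq_sym => ->; rewrite mul0r.
    rewrite (bigD1 j) //= eqxx mulr1 big1 ?addr0 // => q /negPf.
    by rewrite eq_sym => ->; rewrite mulr0 mul0r.
  under eq_bigr do rewrite mxE mulr_suml.
  rewrite exchange_big /=; apply: eq_bigr => p _.
  rewrite /lin_apply -sumrB mulr_sumr; apply: eq_bigr => q _.
  rewrite !mxE; ring.
apply: le_trans (ler_norm_sum _ _ _) _.
rewrite mulr_natl -[in leRHS](card_ord m) -sumr_const; apply: ler_sum => p _.
rewrite normrM ler_pM //; apply: le_trans (ler_normB _ _) _; rewrite lerD //.
apply: le_trans (ler_norm_sum _ _ _) _.
rewrite mulr_natl -[in leRHS](card_ord d) -sumr_const; apply: ler_sum => q _.
by rewrite normrM ler_pM // (le_trans (le_mx_supnorm _ _ _)).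
Qed.

End Degenerate.

(** * Solution counts for functions of two coordinates *)

Section Counting.
Variables (R : realType) (m d : nat) (L : 'M[R]_(m, d)) (eps : R) (N : nat).

Definition sol_weight (k : {ffun 'I_d -> 'I_(2 * N + 1)}) : R :=
  ind_box1N N (fun j => (box_pt k j)%:~R) *
  ind_cube eps (lin_apply L (fun j => (box_pt k j)%:~R)).

(** Absolute values lose nothing where [sol_weight] is non-zero, since the coordinates are positive
    there. *)
Definition pt_nat (k : {ffun 'I_d -> 'I_(2 * N + 1)}) (q : 'I_d) : nat :=
  absz (box_pt k q).

Lemma sol_weight_ge0 k : 0 <= sol_weight k.
Proof.
by rewrite /sol_weight /ind_box1N /ind_cube; do 2!case: ifP; rewrite ?mulr0 ?mulr1.
Qed.

Lemma sol_weight_neq0 k : sol_weight k != 0 ->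
  (forall q, 1 <= box_pt k q <= N%:Z) /\
  (forall p, `|lin_apply L (fun j => (box_pt k j)%:~R) p| <= eps).
Proof.
rewrite /sol_weight /ind_box1N /ind_cube.
case: ifP => [/forallP box|]; last by rewrite mul0r eqxx.
case: ifP => [/forallP cube _|]; last by rewrite mulr0 eqxx.
split=> // q; have := box q.
by rewrite -[1]/(1%:~R) -[N%:R]/(N%:Z%:~R) !ler_int.
Qed.

Definition two_point (i j : 'I_d) (a b : nat -> R) (q : 'I_d) : nat -> R :=
  if q == i then a else if q == j then b else fun=> 1.

(** On the support of the weight [ext0] changes nothing, and all factors but those at [i] and [j]
    are [1]. *)
Lemma solT_two_point i j a b : i != j ->
  solT L (@ind_box1N R d N) (@ind_cube R m eps) N (two_point i j a b) =
  N%:R ^- (d - m) * \sum_k sol_weight k * (a (pt_nat k i) * b (pt_nat k j)).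
Proof.
move=> ij; rewrite /solT; congr (_ * _); apply: eq_bigr => k _.
rewrite -mulrA -/(sol_weight k).
have [->|/sol_weight_neq0[box _]] := eqVneq (sol_weight k) 0; first by rewrite mulr0 mul0r.
rewrite mulrC; congr (_ * _).
have extE q : ext0 N (two_point i j a b q) (box_pt k q) = two_point i j a b q (pt_nat k q).
  by rewrite /ext0 box.
rewrite (bigD1 i) // (bigD1 j) /=; last by rewrite eq_sym.
rewrite !extE /two_point eqxx eq_sym (negPf ij) eqxx big1 ?mulr1 //.
move=> q /andP[qi qj]; rewrite /ext0 box.
by rewrite (negPf qi) (negPf qj).
Qed.

Lemma solT_const1 :
  solT L (@ind_box1N R d N) (@ind_cube R m eps) N (fun _ _ => 1) =
  N%:R ^- (d - m) * \sum_k sol_weight k.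
Proof.
rewrite /solT; congr (_ * _); apply: eq_bigr => k _.
rewrite -mulrA -/(sol_weight k).
have [->|/sol_weight_neq0[box _]] := eqVneq (sol_weight k) 0; first by rewrite mulr0.
by rewrite big1 ?mul1r // => q _; rewrite /ext0 box.
Qed.

End Counting.

(** * Averaging over shifts and signs *)

Section Averaging.
Variables (R : realType) (m d : nat) (L : 'M[R]_(m, d)) (eps : R) (N B : nat).
Variables (i j : 'I_d) (phi : nat -> nat) (D : nat).
Hypotheses (N_gt0 : (0 < N)%N) (B_gt0 : (0 < B)%N) (ij : i != j).
Hypothesis phi_le : forall n, (phi n <= N)%N.
Hypothesis phi_close : forall k, sol_weight L eps k != 0 ->
  (pt_nat k i <= phi (@pt_nat d N k j) + D)%N /\ (phi (pt_nat k j) <= pt_nat k i + D)%N.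

Let T f := solT L (@ind_box1N R d N) (@ind_cube R m eps) N f.

(** [phi] will be multiplication by [lam], rounded and clamped, so that the two signs mostly agree
    at a solution. *)
Definition correlated_signs t (sg : {ffun 'I_(N + B).+1 -> bool}) : 'I_d -> nat -> R :=
  two_point i j (block_signs R t sg) (block_signs R t sg \o phi).

(** Over the signs, a solution averages to [1] if [n_i] and [phi n_j] share a block and to [0]
    otherwise; at most [D] of the [B] shifts separate them. *)
Lemma sum_solT_correlated :
  2 ^+ (N + B).+1 * (B%:R - D%:R) * T (fun _ _ => 1) <=
  \sum_(t < B) \sum_(sg : {ffun 'I_(N + B).+1 -> bool}) T (correlated_signs t sg).
Proof.
rewrite /T solT_const1.
under [leRHS]eq_bigr do under eq_bigr do rewrite solT_two_point //.
under [leRHS]eq_bigr do rewrite -mulr_sumr exchange_big.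
rewrite -mulr_sumr exchange_big /= mulrCA ler_wpM2l ?invr_ge0 ?exprn_ge0 ?ler0n //.
rewrite mulr_sumr; apply: ler_sum => k _.
under eq_bigr do rewrite -mulr_sumr.
rewrite -mulr_sumr [leLHS]mulrC.
have [->|/[dup] /sol_weight_neq0[box _] k0] := eqVneq (sol_weight L eps k) 0.
  by rewrite !mul0r.
rewrite ler_wpM2l ?sol_weight_ge0 //.
under eq_bigr do rewrite sum_sign_pair card_ord mulrC.
rewrite -mulr_sumr ler_wpM2l ?exprn_ge0 //.
have [le1 le2] := phi_close k0.
have kiN : (pt_nat k i <= N)%N by have := box i; rewrite /pt_nat; lia.
have := card_shift_separating B_gt0 kiN (phi_le _) le1 le2.
rewrite -(ler_nat R) natr_sum => le_D.
rewrite lerBlDr -[X in X%:R <= _](card_ord B) -sumr_const.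
apply: le_trans (lerD (lexx _) le_D); rewrite -big_split /=.
by apply: ler_sum => t _; case: eqP; rewrite ?addr0 ?add0r.
Qed.

Lemma solT_correlated_le t sg : T (correlated_signs t sg) <= T (fun _ _ => 1).
Proof.
rewrite /T solT_const1 solT_two_point // ler_wpM2l ?invr_ge0 ?exprn_ge0 ?ler0n //.
apply: ler_sum => k _; rewrite ler_piMr ?sol_weight_ge0 //.
by apply: le_trans (ler_norm _) _; rewrite normrM !normr_sign mulr1.
Qed.

(** A single lower bound on [T f - K * gp], with [gp] the Gowers power, gives both claims: [gp >= 0]
    yields the first, and [T f <= T 1] yields the second. *)
Lemma exists_correlated_signs (s : nat) (tau : R) :
  0 < tau -> (4 * D < B)%N -> 2 * B%:R <= tau * N%:R -> 0 < T (fun _ _ => 1) ->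
  exists t sg, T (fun _ _ => 1) / 2 <= T (correlated_signs t sg) /\
    gowers_pow (2 ^ (s.+1 + 1) * N).+1 s.+1 (trunc N (block_signs R t sg)) <= tau.
Proof.
move=> tau0 DB BN T1_gt0.
pose gp t sg := gowers_pow (2 ^ (s.+1 + 1) * N).+1 s.+1
  (trunc N (@block_signs R N B t sg)).
have gp_ge0 t sg : 0 <= gp t sg by apply: gowers_pow_ge0.
set T1 := T (fun _ _ => 1) in T1_gt0 *.
(* This makes [K * tau] equal to [T1 / 2], the slack between [T1] and the lower bound wanted. *)
pose K := T1 / (2 * tau).
have K0 : 0 < K by rewrite divr_gt0 // mulr_gt0.
have KE : K * tau = T1 / 2 by rewrite /K; field; rewrite gt_eqF.
suff [t [sg le_T]] : exists (t : 'I_B) sg,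
    T1 / 2 + K * gp t sg <= T (correlated_signs t sg).
  exists t, sg; split; first by apply: le_trans le_T; rewrite lerDl mulr_ge0 // ltW.
  have := le_trans le_T (solT_correlated_le t sg); rewrite -/T1 => le_T1.
  rewrite -/(gp t sg) -(ler_pM2l K0) KE; lra.
apply: contrapT => no_ex.
have lt_T (t : 'I_B) sg : T (correlated_signs t sg) < T1 / 2 + K * gp t sg.
  by rewrite ltNge; apply/negP => le_T; apply: no_ex; exists t, sg.
set P : R := 2 ^+ (N + B).+1.
have P0 : 0 < P by rewrite exprn_gt0.
have sum_le : \sum_(t < B) \sum_sg T (correlated_signs t sg) <=
    P * B%:R * (T1 / 2) + K * (B%:R * (P * (B%:R / N%:R))).
  apply: le_trans (ler_sum _ (fun t _ => ler_sum _ (fun sg _ => ltW (lt_T t sg)))) _.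
  under eq_bigr do rewrite big_split /=.
  rewrite big_split /= lerD //.
    rewrite !sumr_const card_ffun card_bool !card_ord.
    by rewrite -[leLHS]mulr_natl -[X in _ * X]mulr_natl natrX -/P mulrA (mulrC B%:R).
  under eq_bigr do rewrite -mulr_sumr.
  rewrite -mulr_sumr ler_wpM2l ?(ltW K0) //.
  rewrite [leRHS]mulr_natl -[X in _ *+ X](card_ord B) -sumr_const.
  by apply: ler_sum => t _; apply: sum_signs_gowers_pow.
have := le_trans sum_solT_correlated sum_le; rewrite -/T1 -/P.
move: T1 T1_gt0 K K0 KE {lt_T no_ex sum_le} => T1 T1_gt0 K K0 KE.
have N0 : 0 < N%:R :> R by rewrite ltr0n.
have KB : K * (B%:R / N%:R) <= T1 / 4.
  have BN' : B%:R / N%:R <= tau / 2 by rewrite ler_pdivrMr //; lra.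
  by apply: le_trans (ler_wpM2l (ltW K0) BN') _; lra.
rewrite (_ : K * _ = P * (B%:R * (K * (B%:R / N%:R)))); last by ring.
rewrite -!mulrA -mulrDr ler_pM2l //.
move: (K * _) KB => X KB le1.
have BKB := ler_wpM2l (ler0n R B) KB.
(* Comparing averages gives [(B - D) * T1 <= 3 / 4 * B * T1], against [4 * D < B]. *)
have : 4 * D%:R * T1 < B%:R * T1 by rewrite ltr_pM2r // -natrM ltr_nat.
lra.
Qed.

End Averaging.

(** * Sign functions at a nearly degenerate matrix *)

Section Correlation.
Variables (R : realType) (m d : nat).
Implicit Types (L : 'M[R]_(m, d)).

(** [K] is fixed before [L] and [eta], so that [eta] can later be taken small against it. *)
Lemma near_degen_correlation (eps c : R) : (1 < d)%N -> 0 < eps -> 0 < c ->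
  exists2 K : R, 0 < K & forall L (eta : R), 0 <= eta -> eta <= c / 2 ->
    (c%:E <= mx_dist L (@V_rank R m d))%E ->
    (mx_dist L (@V_degen R m d) < eta%:E)%E ->
  exists i j (lam : R), i != j /\ forall (N : R) (x : 'I_d -> R),
    (forall q, `|x q| <= N) -> (forall p, `|lin_apply L x p| <= eps) ->
    `|x i - lam * x j| <= K * (1 + eta * N).
Proof.
move=> d1 eps0 c0; have c20 : 0 <= 2 / c by rewrite divr_ge0 // ltW.
have K0 : 0 <= m%:R * (2 / c * (eps + d%:R)).
  by rewrite mulr_ge0 ?ler0n // mulr_ge0 // addr_ge0 ?ler0n // ltW.
exists (m%:R * (2 / c * (eps + d%:R)) + 1); first lra.
move=> L eta eta0 eta_c distL /ereal_inf_lt[_ [M Mdegen <-]].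
rewrite lte_fin => /ltW LM.
have [i [j [lam [u [ij lam1 uM]]]]] := V_degen_normal_form d1 Mdegen.
exists i, j, lam; split => // N x xN Lx.
have u_le : forall p, `|u 0 p| <= 2 / c.
  apply: (row_coef_bound c0 eta_c distL LM uM) => q.
  rewrite !mxE !eqxx /=; case: (eqVneq q i) => [->|_].
    by rewrite (negPf ij) mulr0 subr0 normr1.
  rewrite sub0r normrN normrM mulr_ile1 ?normr_ge0 //.
  by case: eqP; rewrite ?normr1 ?normr0.
apply: le_trans (near_degen_solution uM u_le LM xN Lx) _.
have etaN0 : 0 <= eta * N by rewrite mulr_ge0 // (le_trans (normr_ge0 _) (xN i)).
apply: (@le_trans _ _ (m%:R * (2 / c * ((eps + d%:R) * (1 + eta * N))))); last first.
  rewrite [leLHS](_ : _ = m%:R * (2 / c * (eps + d%:R)) * (1 + eta * N)).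
    by rewrite ler_wpM2r ?lerDl // addr_ge0.
  by rewrite !mulrA.
rewrite ler_wpM2l ?ler0n // ler_wpM2l //.
have := mulr_ge0 (ltW eps0) etaN0; have := ler0n R d; lra.
Qed.

(** [Num.truncn] sends negative reals to [0], and the cap [N] keeps values where [block] is
    faithful. *)
Definition clamp_scale (N : nat) (lam : R) (n : nat) : nat :=
  minn N (Num.truncn (lam * n%:R)).

(** Rounding costs less than [1], and clamping cannot move a point away from [a], itself in
    [[0, N]]. *)
Lemma clamp_scale_close (N D a b : nat) (lam Delta : R) :
  (a <= N)%N -> `|a%:R - lam * b%:R| <= Delta -> Delta + 1 <= D%:R ->
  (a <= clamp_scale N lam b + D)%N /\ (clamp_scale N lam b <= a + D)%N.
Proof.
move=> aN near D_ge; move: near; rewrite ler_norml => /andP[nearl nearr].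
rewrite /clamp_scale; move: (lam * _) nearl nearr => y nearl nearr.
have [y0|y0] := leP 0 y.
  have /andP[ty1 ty2] := truncn_itv y0.
  have le1 : (a <= Num.truncn y + D)%N.
    by rewrite -(ler_nat R) natrD; move: ty2; rewrite -natr1; lra.
  have le2 : (Num.truncn y <= a + D)%N by rewrite -(ler_nat R) natrD; lra.
  by move: (Num.truncn y) le1 le2 => t; lia.
have -> : Num.truncn y = 0%N by apply/truncn0Pn; rewrite -ltNge; lra.
have : (a <= D)%N by rewrite -(ler_nat R); lra.
by rewrite minn0; lia.
Qed.

Lemma exists_uniform_large_count L (eps lam Delta tau : R) (N s : nat) i j :
  let T f := solT L (@ind_box1N R d N) (@ind_cube R m eps) N f in
  i != j -> (0 < N)%N -> 0 <= Delta ->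
  (forall x : 'I_d -> R, (forall q, `|x q| <= N%:R) ->
     (forall p, `|lin_apply L x p| <= eps) -> `|x i - lam * x j| <= Delta) ->
  0 < tau -> 4 * Delta + 9 <= tau * N%:R / 2 -> 0 < T (fun _ _ => 1) ->
  exists f, [/\ forall q n, -1 <= f q n <= 1,
    gowers_pow (2 ^ (s.+1 + 1) * N).+1 s.+1 (trunc N (f i)) <= tau
    & T (fun _ _ => 1) / 2 <= T f].
Proof.
move=> T ij N_gt0 Delta0 close tau0 DeltaN T1_gt0.
have [D D_le D_ge] : exists2 D : nat, D%:R <= Delta + 2 & Delta + 1 <= D%:R.
  exists (Num.truncn Delta).+2; first by rewrite -addn2 natrD lerD2r truncn_le.
  by rewrite -natr1 lerD2r ltW ?truncnS_gt.
have [B B_le B_gt] : exists2 B : nat,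
    B%:R <= tau * N%:R / 2 & tau * N%:R / 2 < B%:R + 1.
  exists (Num.truncn (tau * N%:R / 2)); last by rewrite natr1 truncnS_gt.
  by rewrite truncn_le; lra.
(* Here [4 * D <= 4 * Delta + 8] while [B > tau * N / 2 - 1]; hence the constant [9]. *)
have DB : (4 * D < B)%N by rewrite -(ltr_nat R) natrM; lra.
have B_gt0 : (0 < B)%N by apply: leq_trans DB.
have phi_le n : (clamp_scale N lam n <= N)%N by rewrite geq_minl.
have phi_close (k : {ffun 'I_d -> 'I_(2 * N + 1)}) : sol_weight L eps k != 0 ->
    (pt_nat k i <= clamp_scale N lam (pt_nat k j) + D)%N /\
    (clamp_scale N lam (pt_nat k j) <= pt_nat k i + D)%N.
  move=> /sol_weight_neq0[box cube].
  have ptE q : (box_pt k q)%:~R = (pt_nat k q)%:R :> R.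
    have /andP[q1 _] := box q.
    by rewrite /pt_nat -[in LHS](@gez0_abs (box_pt k q)) // (le_trans _ q1).
  have pt_le q : (pt_nat k q <= N)%N.
    by have := box q; rewrite /pt_nat; move: (box_pt k q); lia.
  apply: clamp_scale_close D_ge; first exact: pt_le.
  rewrite -!ptE; apply: close cube => q.
  by rewrite ptE ger0_norm ?ler0n // ler_nat.
have BN : 2 * B%:R <= tau * N%:R by lra.
have [t [sg [T_ge gp_le]]] :=
  exists_correlated_signs N_gt0 B_gt0 ij phi_le phi_close s tau0 DB BN T1_gt0.
exists (correlated_signs R i j (clamp_scale N lam) t sg); split => // [q n|].
  rewrite -ler_norml /correlated_signs /two_point.
  by case: ifP => _; [|case: ifP => _]; rewrite ?normr1 //= normr_sign.
by rewrite /correlated_signs /two_point eqxx.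
Qed.

End Correlation.

(** * Choice of the parameters *)

Unset Implicit Arguments. Set Strict Implicit. Set Printing Implicit Defensive.

Theorem theorem2p12 (R : realType) (m d : nat) (eps c C : R)
    (Lseq : nat -> 'M[R]_(m, d)) (s : nat) (H : R -> R) (E : R -> nat -> R) :
  (m.+2 <= d)%N -> 0 < eps -> 0 < c -> 0 < C ->
  (forall N, mx_supnorm (Lseq N) <= C) ->
  (forall N, (c%:E <= mx_dist (Lseq N) (@V_rank R m d))%E) ->
  (exists kappa : R, 0 < kappa /\ exists N0 : nat, forall N : nat, (N0 <= N)%N ->
      kappa <= solT (Lseq N) (@ind_box1N R d N) (@ind_cube R m eps) N (fun _ _ => 1)) ->
  limn_einf (fun N => mx_dist (Lseq N) (@V_degen R m d)) = 0%E ->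
  (forall rho, 0 < rho -> 0 < H rho) ->
  H x @[x --> 0^'+] --> 0 ->
  (forall rho, 0 < rho -> E rho N @[N --> \oo] --> 0) ->
  forall N0 : nat, exists N : nat, (N0 <= N)%N /\
    exists f : 'I_d -> nat -> R,
      (forall j n, (1 <= n <= N)%N -> -1 <= f j n <= 1) /\
      exists rho : R, 0 < rho <= 1 /\
        (exists j : 'I_d, gowersN s.+1 N (f j) <= rho) /\
        H rho + E rho N < `|solT (Lseq N) (@ind_box1N R d N) (@ind_cube R m eps) N f|.
Proof.
move=> md eps0 c0 _ _ distL [kappa [kappa0 [N1 T1_ge]]] liminf0 _ H0 E0 N0.
(* [H rho] and [E rho N] get [kappa / 8] each, together below the [kappa / 2] that [T f] will
   reach. *)
have k8 : 0 < kappa / 8 by lra.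
have [rho [rho0 rho1 Hrho]] : exists rho, [/\ 0 < rho, rho <= 1 & H rho < kappa / 8].
  have nearH : \forall x \near 0^'+, H x < kappa / 8 by apply: cvgr_lt H0 _ k8.
  near (0 : R)^'+ => rho; exists rho; split; near: rho => //.
  - exact: nbhs_right_gt.
  - by apply: nbhs_right_le.
have [N2 _ E_lt] : \forall N \near \oo, E rho N < kappa / 8.
  exact: cvgr_lt (E0 _ rho0) _ k8.
have [tau tau0 tau_gowers] : exists2 tau : R, 0 < tau &
    forall N f, (s.+1 < N)%N ->
      gowers_pow (2 ^ (s.+1 + 1) * N).+1 s.+1 (trunc N f) <= tau ->
      gowersN s.+1 N f <= rho.
  exists (rho ^+ (2 ^ s.+1) * gowers_trunc1_lb R s.+1).
    by rewrite mulr_gt0 ?exprn_gt0 ?gowers_trunc1_lb_gt0.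
  by move=> N f sN; apply: gowersN_le.
have d1 : (1 < d)%N by apply: leq_trans md.
have [K K0 near_degen] := @near_degen_correlation R m d eps c d1 eps0 c0.
(* This bounds [4 * K * eta * N] by [tau * N / 4]. Another [tau * N / 4] is left for [4 * K + 9],
   whence [16 * K + 36] below. *)
have [eta [eta0 eta_c eta_tau]] : exists eta : R,
    [/\ 0 < eta, eta <= c / 2 & K * eta <= tau / 16].
  exists (Num.min (c / 2) (tau / 16 / K)); split.
  - by rewrite lt_min; apply/andP; split; rewrite !divr_gt0.
  - by rewrite ge_min lexx.
  - by rewrite mulrC -ler_pdivlMr // ge_min lexx orbT.
have [N3 N3P] : exists N3 : nat, (16 * K + 36) / tau < N3%:R.
  by eexists; apply: truncnS_gt.
(* Every threshold is fixed by now, so the lower limit supplies one [N] beyond all of them. *)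
have [N N_ge distN] := limn_einf_eq0_lt liminf0 eta0 (N0 + N1 + N2 + N3 + s.+2)%N.
have [N0N N1N N2N N3N sN] :
    [/\ N0 <= N, N1 <= N, N2 <= N, N3 <= N & s.+1 < N]%N.
  by clear - N_ge; split; lia.
have N_gt0 : (0 < N)%N by apply: leq_trans sN.
have [i [j [lam [ij close]]]] := near_degen _ _ (ltW eta0) eta_c (distL N) distN.
have N_big : 16 * K + 36 <= tau * N%:R.
  rewrite [leRHS]mulrC -ler_pdivrMr //; apply: le_trans (ltW N3P) _.
  by rewrite ler_nat.
have T1_gt0 := lt_le_trans kappa0 (T1_ge _ N1N).
have N_R0 : 0 <= N%:R :> R by rewrite ler0n.
have Delta0 : 0 <= K * (1 + eta * N%:R).
  by rewrite mulr_ge0 ?addr_ge0 ?mulr_ge0 // ltW.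
have DeltaN : 4 * (K * (1 + eta * N%:R)) + 9 <= tau * N%:R / 2.
  have := ler_wpM2r N_R0 eta_tau; lra.
have [f [f_le gp_le T_ge]] :=
  exists_uniform_large_count s ij N_gt0 Delta0 (close _) tau0 DeltaN T1_gt0.
exists N; split => //; exists f; split; first by move=> q n _; apply: f_le.
exists rho; split; first by rewrite rho0.
split; first by exists i; apply: tau_gowers.
apply: lt_le_trans (ler_norm _).
have := E_lt N N2N; have := T1_ge N N1N; rewrite /=; lra.
Unshelve. all: by end_near.
Qed.
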